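(* Let $B=\{(a,b):a,b\in\{1,2,3\}\}$. For each of the following sets $T$, with $R=B\cup T$, we have $(123,R)\sim_d(132,R)$: (1) $T=\{(0,0)\}$; (2) $T=\{(0,1),(1,0)\}$; (3) $T=\{(0,0),(0,1),(1,0)\}$; (4) $T=\{(0,2),(2,0)\}$; (5) $T=\{(0,0),(0,2),(2,0)\}$; (6) $T=\{(0,1),(0,2),(1,0),(2,0)\}$; (7) $T=\{(0,0),(0,1),(0,2),(1,0),(2,0)\}$.
   Context: $S_n$ denotes the set of permutations of $[n]=\{1,\dots,n\}$, written $\pi=\pi_1\cdots\pi_n$. A mesh pattern of length $k$ is a pair $(\tau,R)$ with $\tau\in S_k$ and $R\subseteq\{0,1,\dots,k\}^2$ (the shaded boxes; box $(a,b)$ is the unit square $[a,a+1]\times[b,b+1]$ in the diagram of $\tau$). An occurrence of $(\tau,R)$ in $\pi\in S_n$ is a choice of indices $i_1<\dots<i_k$ such that $\pi_{i_1}\cdots\pi_{i_k}$ is order-isomorphic to $\tau$ and, with $i_0=0$, $i_{k+1}=n+1$, $v_1<\dots<v_k$ the values $\pi_{i_1},\dots,\pi_{i_k}$ sorted increasingly, $v_0=0$, $v_{k+1}=n+1$, for every $(a,b)\in R$ there is no index $m$ with $i_a<m<i_{a+1}$ and $v_b<\pi_m<v_{b+1}$. Mesh patterns $p,q$ are equidistributed, $p\sim_d q$, if for all $n,\ell\ge0$ the number of $\pi\in S_n$ with exactly $\ell$ occurrences of $p$ equals the number with exactly $\ell$ occurrences of $q$. *)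

(* Defs.v *)
From mathcomp Require Import all_boot all_fingroup.

Set Implicit Arguments.
Unset Strict Implicit.
Unset Printing Implicit Defensive.

(* ['I_k] has elements 0, .., k-1, so a permutation [pi : 'S_n] is 0-based:  *)
(* the 1-based [pi_i] is [(pi j).+1] with [j = i - 1].  Boxes of a pattern of *)
(* length k are pairs (column, row) in {0, .., k}^2.                          *)
Record mesh_pattern := MeshPattern {
  mesh_len : nat;
  mesh_perm : 'S_mesh_len;
  mesh_shade : {set 'I_mesh_len.+1 * 'I_mesh_len.+1}
}.

Section Occurrence.

Variables (k n : nat) (pi : 'S_n) (f : {ffun 'I_k -> 'I_n}).

(* [:: i_0; i_1; ..; i_k; i_(k+1)], 1-based, with i_0 = 0, i_(k+1) = n+1. *)
Definition pos_bounds : seq nat :=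
  0 :: rcons [seq (f j).+1 | j <- enum 'I_k] n.+1.

(* [:: v_0; v_1; ..; v_k; v_(k+1)], 1-based, with v_0 = 0, v_(k+1) = n+1. *)
Definition val_bounds : seq nat :=
  0 :: rcons (sort leq [seq (pi (f j)).+1 | j <- enum 'I_k]) n.+1.

Definition increasing : bool :=
  [forall j1 : 'I_k, forall j2 : 'I_k, (j1 < j2) ==> (f j1 < f j2)].

Definition order_isomorphic (tau : 'S_k) : bool :=
  [forall j1 : 'I_k, forall j2 : 'I_k,
    (pi (f j1) < pi (f j2)) == (tau j1 < tau j2)].

Definition in_box (ab : 'I_k.+1 * 'I_k.+1) (m : 'I_n) : bool :=
  (nth 0 pos_bounds ab.1 < m.+1 < nth 0 pos_bounds ab.1.+1) &&
  (nth 0 val_bounds ab.2 < (pi m).+1 < nth 0 val_bounds ab.2.+1).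

End Occurrence.

Definition occurrence (p : mesh_pattern) (n : nat) (pi : 'S_n)
    (f : {ffun 'I_(mesh_len p) -> 'I_n}) : bool :=
  [&& increasing f, order_isomorphic pi f (mesh_perm p) &
      [forall ab in mesh_shade p, forall m : 'I_n, ~~ in_box pi f ab m]].
Arguments occurrence p [n] pi f.

Definition num_occ (p : mesh_pattern) (n : nat) (pi : 'S_n) : nat :=
  #|[set f | occurrence p pi f]|.

Definition equidistributed (p q : mesh_pattern) : Prop :=
  forall n l : nat,
    #|[set pi : 'S_n | num_occ p pi == l]| =
    #|[set pi : 'S_n | num_occ q pi == l]|.

Notation "p ~d q" := (equidistributed p q) (at level 70, no associativity).

Definition boxes3 (s : seq (nat * nat)) : {set 'I_4 * 'I_4} :=
  [set ab : 'I_4 * 'I_4 | (val ab.1, val ab.2) \in s].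

Definition B : {set 'I_4 * 'I_4} :=
  [set ab : 'I_4 * 'I_4 | (1 <= ab.1 <= 3) && (1 <= ab.2 <= 3)].

Definition perm123 : 'S_3 := 1%g.

(* One-line notation 132: fixes 1 and exchanges 2 and 3 (0-based 1 and 2). *)
Definition perm132 : 'S_3 :=
  tperm (@Ordinal 3 1 isT) (@Ordinal 3 2 isT).

(* Main.v *)
(* In an occurrence the first letter x has exactly two letters to its right  *)
(* above it, and these form an ascent (123) or a descent (132).  Insert the   *)
(* values in decreasing order and let a_t be the number of letters to the     *)
(* right of the t-th one (t >= 0) when it is inserted; a is the Lehmer code   *)
(* of a permutation.  Then x is inserted at a time t with a_t = 2, its two    *)
(* companions are the last two letters of the word at that time, and if u is  *)
(* the last time before t with a_u <= 1, they ascend iff a_u = 1.  The boxes  *)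
(* translate too: (0,1) is empty iff u = t-1, (0,2) is empty iff              *)
(* a_(u-1) = 0, and (0,0), (1,0), (2,0) are empty iff no later letter enters  *)
(* the gap before x, between x and its first companion, or between the two    *)
(* companions.  The involution on codes that exchanges 0 and 1 at all u > 0   *)
(* with a_u <= 1 exchanges the two patterns and does not affect gaps with at  *)
(* least one letter on their right, which settles T without (0,2) and (2,0).  *)
(* If (0,2) is in T, exchange only where a_(u-1) = 0 and a_(u+1) >= 2: this   *)
(* covers all occurrences, and leaves the last gap undisturbed as well.       *)
Require Import Defs.
From mathcomp Require Import all_boot all_fingroup.
From mathcomp Require Import zify.

Set Implicit Arguments.
Unset Strict Implicit.
Unset Printing Implicit Defensive.

(** Shading [B] leaves the first letter of an occurrence exactly two larger letters on its right, so
    that letter determines the occurrence ([isolated3_inj]), and [num_occ_code] counts occurrences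
    as times t of the Lehmer code that satisfy [code_occ]. For the two patterns this condition
    differs in one bit only, the code entry at u = [last_low a t]. The map [flip] toggles that bit
    and keeps the rest ([code_occ_flip]), because most box conditions only ask which entries are at
    most 1 or compare entries with ranks at least 1, and so cannot tell 0 from 1.

    Two boxes are more delicate: (0,2) reads the entry before u, and (2,0) involves the last
    companion, whose rank starts at 0. The restricted flip respects both, but it reaches every
    relevant u only if (0,2) is shaded; hence the requirement that (2,0) in [T] forces (0,2) in [T].
    Since codes correspond bijectively to permutations ([perm_code_inj], [perm_code_surj]), the flip
    becomes a permutation of ['S_n] that carries one statistic to the other
    ([equidistributed_flip]). *)

Lemma sum_nat_pred1 m u : u < m -> \sum_(r < m) (r == u :> nat : nat) = 1.
Proof.
move=> lt_um; rewrite (bigD1 (Ordinal lt_um)) //= eqxx big1 // => r.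
by rewrite -val_eqE /= => /negbTE ->.
Qed.

(** * Ranks and Lehmer codes *)

Definition rank_upto (q : nat -> nat) (t s : nat) : nat :=
  \sum_(r < s) (q r < q t).

Definition lehmer (q : nat -> nat) (t : nat) : nat := rank_upto q t t.

Lemma rank_uptoS q t s : rank_upto q t s.+1 = rank_upto q t s + (q s < q t).
Proof. by rewrite /rank_upto big_ord_recr. Qed.

Lemma leq_rank_upto q t : {homo rank_upto q t : m s / m <= s}.
Proof.
by apply: homo_leq => // [m s r|s]; [exact: leq_trans | rewrite rank_uptoS leq_addr].
Qed.

Lemma rank_upto_gt0 q t r s : r < s -> q r < q t -> 0 < rank_upto q t s.
Proof.
by move=> lt_rs lt_rt; rewrite /rank_upto (bigD1 (Ordinal lt_rs)) //= lt_rt.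
Qed.

Lemma lehmer_le q t : lehmer q t <= t.
Proof.
rewrite -[leqRHS]card_ord -sum1_card.
by apply: leq_sum => r _; exact: leq_b1.
Qed.

(** If [q s < q t], everything counted for [s] is counted for [t]; otherwise [t] itself is counted
    for [s] on top of all that is counted for [t]. Thus the code alone decides on which side of an
    older letter a new one lands. *)
Lemma lehmer_le_rank q t s : injective q -> t < s ->
  (lehmer q s <= rank_upto q t s) = (q s < q t).
Proof.
move=> q_inj lt_ts; case: (ltngtP (q s) (q t)) => [lt_st|lt_ts'|/q_inj st].
- by apply: leq_sum => r _; have := lt_st; lia.
- apply/negbTE; rewrite -ltnNge -addn1 -(sum_nat_pred1 lt_ts) -big_split.
  apply: leq_sum => r _ /=.
  by case: (r =P t :> nat) => [->|_] /=; lia.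
- by move: lt_ts; rewrite st ltnn.
Qed.

(* The number of elements to the right of a letter after the insertions at   *)
(* times [t + 1, .., t + d], if there were [k] of them at time [t].           *)
Fixpoint rank (a : nat -> nat) (t k d : nat) : nat :=
  if d is d'.+1 then rank a t k d' + (a (t + d) <= rank a t k d') else k.

Lemma rank_ge a t k d : k <= rank a t k d.
Proof. by elim: d => //= d IHd; lia. Qed.

Lemma rank_gt0 a t k d : 0 < k -> 0 < rank a t k d.
Proof. by move=> k_gt0; exact: leq_trans k_gt0 (rank_ge _ _ _ _). Qed.

Lemma rank_uptoE q y t d : injective q -> y <= t ->
  rank_upto q y (t + d).+1 = rank (lehmer q) t (rank_upto q y t.+1) d.
Proof.
move=> q_inj le_yt; elim: d => [|d IHd]; first by rewrite addn0.
rewrite rank_uptoS addnS IHd /= -IHd addnS lehmer_le_rank //; lia.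
Qed.

(** * Occurrence conditions on a code *)

Fixpoint last_low (a : nat -> nat) (t : nat) : nat :=
  if t is t'.+1 then if a t' <= 1 then t' else last_low a t' else 0.

Lemma last_lowE a t u : u < t -> a u <= 1 ->
  (forall s, u < s < t -> 1 < a s) -> last_low a t = u.
Proof.
elim: t => // t IHt; rewrite ltnS leq_eqVlt => /orP[/eqP-> /= -> //|lt_ut] au hs.
rewrite /= leqNgt hs ?ltnSn ?andbT //=.
by apply: IHt => // s /andP[us st]; apply: hs; lia.
Qed.

Lemma last_lowP a t : a 0 <= 1 -> 0 < t ->
  [/\ last_low a t < t, a (last_low a t) <= 1 &
      forall s, last_low a t < s < t -> 1 < a s].
Proof.
move=> a0; elim: t => // t IHt _ /=.
case: ifP => [at1|/negbT]; first by split => // s; lia.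
rewrite -ltnNge => at1; case: t => [|t] in IHt at1 *; first by lia.
have [// | lt_u au hs] := IHt; split => //; first by lia.
move=> s /andP[us]; rewrite ltnS leq_eqVlt => /orP[/eqP-> //|st].
by apply: hs; rewrite us.
Qed.

Definition axis_boxes : seq (nat * nat) :=
  [:: (0, 0); (0, 1); (0, 2); (1, 0); (2, 0)].

(** Here [d] stands for the insertion at time [t + d.+1], and [rank a t k d] for k = 2, 1, 0 is the
    rank of the first, second, third letter of the occurrence just before it. The new letter goes to
    the left of a letter exactly when its entry exceeds that letter's rank. *)
Definition code_box (n : nat) (a : nat -> nat) (t : nat) (ab : nat * nat) :=
  match ab with
  | (0, 0) => [forall d : 'I_(n - t.+1), a (t + d.+1) <= rank a t 2 d]
  | (0, 1) => last_low a t == t.-1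
  | (0, 2) => a (last_low a t).-1 == 0
  | (1, 0) => [forall d : 'I_(n - t.+1),
      ~~ (rank a t 1 d < a (t + d.+1) <= rank a t 2 d)]
  | (2, 0) => [forall d : 'I_(n - t.+1),
      ~~ (rank a t 0 d < a (t + d.+1) <= rank a t 1 d)]
  | _ => true
  end.

Definition code_occ (n : nat) (a : nat -> nat) (T : {set 'I_4 * 'I_4})
    (up : bool) (t : nat) : bool :=
  [&& a t == 2, a (last_low a t) == up &
      [forall ab in T, code_box n a t (val ab.1, val ab.2)]].

Lemma eq_rank n a a' t k d : (forall s, s < n -> a s = a' s) -> t + d < n ->
  rank a t k d = rank a' t k d.
Proof. by move=> eq_a; elim: d => //= d IHd lt_d; rewrite eq_a // IHd //; lia. Qed.

(** A permutation in ['S_n] realises a prescribed code only at times below [n]. *)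
Lemma eq_code_occ n a a' T up t : (forall s, s < n -> a s = a' s) -> t < n ->
  code_occ n a T up t = code_occ n a' T up t.
Proof.
move=> eq_a lt_tn.
have ll s : s <= n -> last_low a s = last_low a' s.
  elim: s => // s IHs lt_sn /=; rewrite eq_a // IHs //; exact: ltnW.
have ll_lt : last_low a' t < n.
  apply: leq_ltn_trans lt_tn; elim: (t) => //= s; case: ifP => // _; lia.
have rk k d : t + d < n -> rank a t k d = rank a' t k d by exact: eq_rank.
rewrite /code_occ eq_a // ll 1?ltnW // eq_a //; congr [&& _, _ & _].
apply: eq_forallb => ab; congr (_ ==> _).
rewrite /code_box; case: (val ab.1) (val ab.2) => [|[|[|?]]] [|[|[|?]]] //.
- by apply: eq_forallb => d; rewrite eq_a ?rk //; have := ltn_ord d; lia.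
- by rewrite ll // ltnW.
- by rewrite ll 1?ltnW // eq_a //; lia.
- by apply: eq_forallb => d; rewrite eq_a ?rk //; have := ltn_ord d; lia.
- by apply: eq_forallb => d; rewrite eq_a ?rk //; have := ltn_ord d; lia.
Qed.

(** * The flip involution on codes *)

Definition flippable (b : bool) (a : nat -> nat) (u : nat) : bool :=
  [&& 0 < u, a u <= 1 & b ==> (a u.-1 == 0) && (1 < a u.+1)].

Definition flip (b : bool) (a : nat -> nat) (u : nat) : nat :=
  if flippable b a u then 1 - a u else a u.

(** At u = n - 1 the test looks at entry [n], but only through its comparison with 1. *)
Lemma eq_flip n b a a' : (forall u, u < n -> a u = a' u) ->
  (1 < a n) = (1 < a' n) -> forall u, u < n -> flip b a u = flip b a' u.
Proof.
move=> eq_a eq_n u lt_un.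
have eqS : (1 < a u.+1) = (1 < a' u.+1).
  by move: lt_un; rewrite leq_eqVlt => /orP[/eqP->|/eq_a->].
by rewrite /flip /flippable eqS !eq_a // (leq_ltn_trans (leq_pred u)).
Qed.

Lemma flip_le b a u r : 0 < r -> (flip b a u <= r) = (a u <= r).
Proof. by rewrite /flip /flippable; case: ifP => // /and3P[]; lia. Qed.

Lemma flip_pred a u : 0 < u -> a u <= 1 -> flip true a u.-1 = a u.-1.
Proof.
by move=> u_gt0 au; rewrite /flip /flippable prednK // (ltnNge 1 (a u)) au !andbF.
Qed.

(** The restricted test survives the flip: the entry before [u] is followed by one that is at most
    1, so it is not flippable itself, and the entry after [u] stays above 1. *)
Lemma flippable_flip b a u : flippable b (flip b a) u = flippable b a u.
Proof.
rewrite /flippable flip_le // (ltnNge 1) flip_le // -ltnNge.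
case: posnP => //= u_gt0; case: (leqP (a u) 1) => //= au.
by case: b => //=; rewrite flip_pred.
Qed.

Lemma flipK b a : flip b (flip b a) =1 a.
Proof.
move=> u; rewrite {1}/flip flippable_flip /flip.
by case: (boolP (flippable b a u)) => // /and3P[_ au _]; lia.
Qed.

Lemma flip_valid b a u : a u <= u -> flip b a u <= u.
Proof. by rewrite /flip; case: ifP => // /and3P[]; lia. Qed.

Lemma last_low_flip b a t : last_low (flip b a) t = last_low a t.
Proof. by elim: t => //= t ->; rewrite flip_le. Qed.

Lemma rank_flip b a t k d : 0 < k -> rank (flip b a) t k d = rank a t k d.
Proof.
by move=> k_gt0; elim: d => //= d ->; rewrite flip_le // rank_gt0.
Qed.

(* The code entry before a flipped one vanishes, so by then the rightmost    *)
(* letter of time [t] has a letter on its right and cannot tell 0 from 1.     *)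
Lemma flip_le_rank0 a t d : a t != 0 ->
  (flip true a (t + d.+1) <= rank a t 0 d) = (a (t + d.+1) <= rank a t 0 d).
Proof.
move=> at0; have [|rk0] := posnP (rank a t 0 d); last exact: flip_le.
rewrite /flip; case: ifP => // /and3P[_ _ /andP[/eqP]]; rewrite addnS /=.
case: d => [|d]; first by rewrite addn0 => /eqP; rewrite (negbTE at0).
by rewrite /= => ->; rewrite leq0n addn1.
Qed.

Lemma rank0_flip a t d : a t != 0 -> rank (flip true a) t 0 d = rank a t 0 d.
Proof. by move=> at0; elim: d => //= d ->; rewrite flip_le_rank0. Qed.

Definition flip_boxes (T : {set 'I_4 * 'I_4}) : bool :=
  [exists ab in T, (val ab.1, val ab.2) == (0, 2)].

Lemma code_occ_flip_imp n a (T : {set 'I_4 * 'I_4}) up t (b := flip_boxes T) :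
  (forall s, a s <= s) ->
  (forall ab, ab \in T -> (val ab.1, val ab.2) = (2, 0) -> b) ->
  code_occ n a T up t -> code_occ n (flip b a) T (~~ up) t.
Proof.
move=> a_le Tb /and3P[/eqP at2 /eqP au /forall_inP boxes].
have t_gt1 : 1 < t by have := a_le t; lia.
have [|lt_ut au1 u_last] := @last_lowP a t _ (ltnW t_gt1).
  exact: leq_trans (a_le 0) _.
set u := last_low a t in au lt_ut au1 u_last *.
(* If u were 0, entry 1 would lie strictly between u and t and exceed 1, against [a 1 <= 1]. *)
have u_gt0 : 0 < u.
  rewrite lt0n; apply/eqP => u0; have := u_last 1; rewrite u0 t_gt1 => /(_ isT).
  by have := a_le 1; lia.
have auS : 1 < a u.+1.
  have [<-|neq] := eqVneq t u.+1; first by rewrite at2.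
  by apply: u_last; lia.
(* When the flip is restricted, the shaded box (0,2) supplies the vanishing of [a u.-1]. *)
have fu : flippable b a u.
  rewrite /flippable u_gt0 au1 auS andbT /=; apply/implyP=> /exists_inP[ab abT].
  by move/eqP=> abE; have := boxes _ abT; rewrite abE.
apply/and3P; split.
- by rewrite /flip /flippable at2 andbF.
- by rewrite last_low_flip -/u /flip fu au; case: (up).
apply/forall_inP => ab abT; have := boxes _ abT; have := Tb _ abT.
have: (val ab.1, val ab.2) = (0, 2) -> b.
  by move=> abE; apply/exists_inP; exists ab => //; apply/eqP.
rewrite /code_box.
case: (val ab.1) (val ab.2) => [|[|[|?]]] [|[|[|?]]] //= Tab2 Tab.
- move/forallP=> H; apply/forallP => d; have := H d.
  by rewrite rank_flip // flip_le // rank_gt0.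
- by rewrite last_low_flip.
- rewrite last_low_flip -/u => /eqP au0.
  by rewrite Tab2 // flip_pred // au0.
- move/forallP=> H; apply/forallP => d; have := H d.
  by rewrite !rank_flip // !(ltnNge (rank _ _ _ _)) !flip_le // rank_gt0.
- rewrite Tab //; move/forallP=> H; apply/forallP => d; have := H d.
  have at0 : a t != 0 by rewrite at2.
  rewrite rank0_flip // rank_flip // !(ltnNge (rank _ _ _ _)).
  by rewrite flip_le_rank0 // flip_le // rank_gt0.
Qed.

Lemma code_occ_flip n a (T : {set 'I_4 * 'I_4}) up t (b := flip_boxes T) :
  (forall s, a s <= s) ->
  (forall ab, ab \in T -> (val ab.1, val ab.2) = (2, 0) -> b) -> t < n ->
  code_occ n (flip b a) T (~~ up) t = code_occ n a T up t.
Proof.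
move=> a_le Tb lt_tn; apply/idP/idP; last exact: code_occ_flip_imp.
(* The converse is the same implication applied to the flipped code. *)
move/code_occ_flip_imp => /(_ (fun s => flip_valid _ (a_le s)) Tb).
rewrite negbK; congr is_true.
by apply: eq_code_occ => // s _; exact: flipK.
Qed.

(** * The boxes of a triple in terms of insertion times *)

(** Further left means larger [q], and lower means inserted later: columns become bounds on [q s]
    and rows bounds on [s], both reversed. *)
Definition triple_box (q : nat -> nat) (t y z : nat) (ab : nat * nat) (s : nat) :=
  match ab with
  | (0, 0) => (q t < q s) && (t < s)
  | (0, 1) => (q t < q s) && (maxn y z < s < t)
  | (0, 2) => (q t < q s) && (minn y z < s < maxn y z)
  | (1, 0) => (q y < q s < q t) && (t < s)
  | (2, 0) => (q z < q s < q y) && (t < s)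
  | _ => false
  end.

(* [t], [y], [z] are the insertion times of the three letters of the pattern, *)
(* from left to right, and [q s] is the final number of letters to the right  *)
(* of the one inserted at time [s].                                           *)
Section Triple.

Variables (q : nat -> nat) (t y z : nat).
Hypotheses (q_inj : injective q) (lt_yt : y < t) (lt_zt : z < t).
Hypotheses (lt_zy : q z < q y) (lt_yt' : q y < q t).
Hypothesis yz_only : forall s, s < t -> q s < q t -> s = y \/ s = z.

Local Notation a := (lehmer q).

Lemma triple_neq : y <> z.
Proof. by move=> yz; move: lt_zy; rewrite yz ltnn. Qed.

(** At time [t] the word ends with the letters of [t], [y], [z] in this order, so their ranks start
    from 2, 1 and 0. *)
Lemma triple_rank0 d : rank_upto q t (t + d).+1 = rank a t 2 d.
Proof.
rewrite rank_uptoE //; congr rank; rewrite rank_uptoS ltnn addn0.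
rewrite -[2](congr2 addn (sum_nat_pred1 lt_yt) (sum_nat_pred1 lt_zt)).
rewrite -big_split; apply: eq_bigr => r _ /=.
have := triple_neq; have := yz_only (ltn_ord r).
by case: (r =P y :> nat) => [->|]; [|case: (r =P z :> nat) => [->|]]; lia.
Qed.

Lemma triple_rank1 d : rank_upto q y (t + d).+1 = rank a t 1 d.
Proof.
rewrite rank_uptoE 1?ltnW //; congr rank.
rewrite rank_uptoS -(sum_nat_pred1 lt_zt) ltnNge ltnW // addn0.
apply: eq_bigr => r _ /=.
have := triple_neq; have := yz_only (ltn_ord r).
by case: (r =P z :> nat) => [->|]; [|case: (r =P y :> nat) => [->|]]; lia.
Qed.

Lemma triple_rank2 d : rank_upto q z (t + d).+1 = rank a t 0 d.
Proof.
rewrite rank_uptoE 1?ltnW //; congr rank.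
rewrite rank_uptoS ltnNge (ltnW (ltn_trans lt_zy _)) // addn0.
apply: big1 => r _ /=; have := triple_neq; have := yz_only (ltn_ord r).
by case: (r =P z :> nat) => [->|]; [|case: (r =P y :> nat) => [->|]]; lia.
Qed.

Lemma triple_lehmer : a t = 2.
Proof. by have := triple_rank0 0; rewrite addn0 rank_uptoS ltnn addn0. Qed.

Lemma triple_between s : s < t -> s != y -> s != z -> q t < q s.
Proof.
move=> lt_st /eqP sy /eqP sz; rewrite ltnNge leq_eqVlt; apply/norP; split.
  by apply/eqP => /q_inj st; rewrite st ltnn in lt_st.
by apply/negP => /(yz_only lt_st)[].
Qed.

Lemma triple_lehmer_z : a z = 0.
Proof.
apply/eqP; rewrite -leqn0 (leq_trans (leq_rank_upto q z (leqW (ltnW lt_zt)))) //.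
by have := triple_rank2 0; rewrite addn0 => ->.
Qed.

Lemma triple_lehmer_y : a y = (z < y).
Proof.
have [lt_zy'|lt_yz|/esym/triple_neq[]//] := ltngtP z y.
  have := leq_rank_upto q y (leqW (ltnW lt_yt)).
  have := triple_rank1 0; rewrite addn0 => -> /=.
  by have := rank_upto_gt0 lt_zy' lt_zy; rewrite /lehmer; lia.
apply: big1 => r _; have := yz_only (ltn_trans (ltn_ord r) lt_yt).
by have := ltn_ord r; case: (r =P z :> nat); case: (r =P y :> nat); lia.
Qed.

(** A letter inserted after both companions and before [t] lies left of the letter of [t], hence
    left of both companions, so its entry is at least 2. *)
Lemma triple_last_low : last_low a t = maxn y z.
Proof.
have yz := triple_neq; apply: last_lowE; first by rewrite gtn_max lt_yt.
  case: (leqP y z) => _; first by rewrite triple_lehmer_z.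
  by rewrite triple_lehmer_y leq_b1.
move=> s /andP[ms st].
have lt_ts : q t < q s by apply: triple_between => //; lia.
have lt_ys : y < s by lia.
have lt_zs : z < s by lia.
have := lehmer_le_rank q_inj lt_ys; rewrite [q s < q y]ltnNge.
rewrite (ltnW (ltn_trans lt_yt' lt_ts)).
by have := rank_upto_gt0 lt_zs lt_zy; lia.
Qed.

Lemma triple_last : a (last_low a t) = (z < y).
Proof.
rewrite triple_last_low; have := triple_neq.
case: (leqP y z) => [yz|zy] _; first by rewrite triple_lehmer_z.
by rewrite triple_lehmer_y zy.
Qed.

(** The earlier companion has entry 0. A letter inserted between the two companions has the earlier
    one on its right, hence a nonzero entry; so [a u.-1] vanishes exactly when the companions are
    inserted consecutively. *)
Lemma triple_between_low :
  (a (last_low a t).-1 == 0) =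
  [forall s : 'I_t, ~~ ((minn y z < s < maxn y z) && (q t < q s))].
Proof.
have yz := triple_neq; rewrite triple_last_low.
set u := maxn y z; set w := minn y z.
have lt_wu : w < u by rewrite /w /u; lia.
have lt_ut : u < t by rewrite /u gtn_max lt_yt.
have between s : w < s < u -> q t < q s.
  by move=> ms; apply: triple_between; move: ms; rewrite /w /u; lia.
have qw : q w < q t.
  by rewrite /w; case: (leqP y z) => _ //; exact: ltn_trans lt_zy lt_yt'.
have aw : a w = 0.
  rewrite /w; case: (leqP y z) => [le_yz|_]; last exact: triple_lehmer_z.
  by rewrite triple_lehmer_y ltnNge le_yz.
have -> : (a u.-1 == 0) = (u.-1 == w).
  apply/idP/eqP => [/eqP au|->]; last by rewrite aw.
  have [//|lt_w] : u.-1 = w \/ w < u.-1 by lia.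
  have lt_tu : q t < q u.-1 by apply: between; lia.
  by have := rank_upto_gt0 lt_w (ltn_trans qw lt_tu); rewrite -/(a u.-1) au.
apply/eqP/forallP => [uw s|none]; first by apply/negP=> /andP[]; lia.
have lt_u1t : u.-1 < t by lia.
have := none (Ordinal lt_u1t); rewrite negb_and => /orP[|] /=; first by lia.
by case: (ltnP w u.-1) => [lt_w /negP[]|]; [apply: between; lia | lia].
Qed.

Lemma triple_later n (P Q : nat -> bool) :
  (forall d, P d = Q (t + d.+1)) ->
  reflect (forall s, s < n -> ~~ (Q s && (t < s)))
          [forall d : 'I_(n - t.+1), ~~ P d].
Proof.
move=> PQ; apply: (iffP forallP) => [none s lt_sn|none d].
  apply/negP=> /andP[Qs lt_ts].
  have lt_d : s - t.+1 < n - t.+1 by lia.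
  have := none (Ordinal lt_d); rewrite PQ /= (_ : t + _ = s) ?Qs //; lia.
have lt_s : t + d.+1 < n by have := ltn_ord d; lia.
by have := none _ lt_s; rewrite PQ (_ : t < _) ?andbT //; lia.
Qed.

Lemma lehmer_gt_rank r s : r < s -> (rank_upto q r s < a s) = (q r < q s).
Proof.
move=> lt_rs; rewrite ltnNge lehmer_le_rank // -leqNgt leq_eqVlt.
by case: eqP => // /q_inj rs; rewrite rs ltnn in lt_rs.
Qed.

Lemma code_boxP n ab : t < n ->
  reflect (forall s, s < n -> ~~ triple_box q t y z ab s) (code_box n a t ab).
Proof.
move=> lt_tn; case: ab => [[|[|[|i]]] [|[|[|j]]]] /=; try by apply: ReflectT.
(* The double negation brings this condition into the shape of [triple_later]. *)
- rewrite -(eq_forallb (fun d => negbK _)).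
  apply: (@triple_later n (fun d => ~~ (a (t + d.+1) <= rank a t 2 d))
    (fun s => q t < q s)) => d.
  by rewrite -triple_rank0 -ltnNge -addnS lehmer_gt_rank //; lia.
- rewrite triple_last_low; have yz := triple_neq.
  apply: (iffP eqP) => [m s lt_sn|none]; first by apply/negP=> /andP[]; lia.
  have [//|lt_m] : maxn y z = t.-1 \/ maxn y z < t.-1 by lia.
  have /none : t.-1 < n by lia.
  by rewrite triple_between //; lia.
- rewrite triple_between_low; apply: (iffP forallP) => [none s lt_sn|none s].
    apply/negP=> /andP[ts ms]; have lt_st : s < t by lia.
    by have := none (Ordinal lt_st); rewrite /= ts ms.
  by rewrite andbC; apply: none; have := ltn_ord s; lia.
- apply: (@triple_later n (fun d => rank a t 1 d < a (t + d.+1) <= rank a t 2 d)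
    (fun s => q y < q s < q t)) => d.
  rewrite -triple_rank1 -triple_rank0 -addnS lehmer_gt_rank ?lehmer_le_rank //; lia.
- apply: (@triple_later n (fun d => rank a t 0 d < a (t + d.+1) <= rank a t 1 d)
    (fun s => q z < q s < q y)) => d.
  rewrite -triple_rank2 -triple_rank1 -addnS lehmer_gt_rank ?lehmer_le_rank //; lia.
Qed.

End Triple.

(** The way back from codes to triples; the companions are named so that [y] is the one further
    left. *)
Lemma lehmer_eq2P q t : injective q -> lehmer q t = 2 ->
  exists y z, [/\ y < t, z < t, q z < q y, q y < q t &
    forall s, s < t -> q s < q t -> s = y \/ s = z].
Proof.
move=> q_inj.
have -> : lehmer q t = #|[set s : 'I_t | q s < q t]|.
  rewrite -sum1dep_card big_mkcond /=; apply: eq_bigr => s _.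
  by case: ltnP.
move/eqP/cards2P => [y [z [yz /setP E]]].
wlog lt_zy : y z yz E / q z < q y.
  have [lt|lt|/q_inj/val_inj eq_zy] := ltngtP (q z) (q y).
  - by move/(_ y z yz E lt).
  - by move/(_ z y); rewrite eq_sym; apply => // s; rewrite E setUC.
  - by rewrite eq_zy eqxx in yz.
exists (val y), (val z); split; [exact: ltn_ord|exact: ltn_ord|exact: lt_zy| |].
  by have := E y; rewrite !inE eqxx.
move=> s lt_st lt_s; have := E (Ordinal lt_st); rewrite !inE /= lt_s.
by case/esym/orP=> /eqP <-; [left | right].
Qed.

(** * The bijection between permutations and codes *)

Section LehmerPerm.

Variable n : nat.
Implicit Type s : 'S_n.

(** Extending by the identity keeps the map injective on [nat] and gives every code the same entry
    at time [n]. *)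
Definition perm_nat s (k : nat) : nat := if insub k is Some i then s i else k.

Lemma perm_natE s (i : 'I_n) : perm_nat s i = s i.
Proof. by rewrite /perm_nat insubT // => lt; congr (val (s _)); apply: val_inj. Qed.

Lemma perm_nat_inj s : injective (perm_nat s).
Proof.
move=> k m; rewrite /perm_nat; case: insubP => [i _ <-|]; case: insubP => [j _ <-|].
- by move/val_inj/perm_inj->.
- by move=> m_ge im; have := ltn_ord (s i); rewrite im (negbTE m_ge).
- by move=> k_ge jm; have := ltn_ord (s j); move: k_ge => /[swap]; rewrite jm => ->.
- by [].
Qed.

Definition perm_code s : nat -> nat := lehmer (perm_nat s).

Lemma rank_upto_perm s (t : 'I_n) : rank_upto (perm_nat s) t n = s t.
Proof.
rewrite /rank_upto (reindex_inj (@perm_inj _ s^-1)) /=.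
under eq_bigr do rewrite !perm_natE permKV.
transitivity (\sum_(k < n | k < s t) 1).
  by rewrite [RHS]big_mkcond; apply: eq_bigr => k _; case: ltnP.
rewrite -(big_ord_widen n (fun=> 1)) 1?ltnW //.
by rewrite sum_nat_const card_ord muln1.
Qed.

Lemma perm_code_n s : perm_code s n = n.
Proof.
rewrite /perm_code /lehmer /rank_upto (eq_bigr (fun=> 1)) => [|r _].
  by rewrite sum_nat_const card_ord muln1.
by rewrite perm_natE /perm_nat insubF ?ltnn // ltn_ord.
Qed.

(** By [rank_uptoE] the code determines all final ranks, and the final rank of [t] is [s t]. *)
Lemma perm_code_inj s s' :
  (forall t, t < n -> perm_code s t = perm_code s' t) -> s = s'.
Proof.
move=> eq_code; apply/permP=> t; apply: val_inj => /=.
rewrite -(rank_upto_perm s) -(rank_upto_perm s').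
have nE : (t + (n - t.+1)).+1 = n by have := ltn_ord t; lia.
rewrite -[X in rank_upto _ _ X]nE -[X in _ = rank_upto _ _ X]nE.
rewrite !rank_uptoE //; try exact: perm_nat_inj.
rewrite !rank_uptoS !ltnn !addn0 -!/(lehmer _ _) -!/(perm_code _).
rewrite eq_code //; apply: eq_rank eq_code _; lia.
Qed.

Lemma perm_code_surj (a : nat -> nat) : (forall t, a t <= t) ->
  exists s : 'S_n, forall t, t < n -> perm_code s t = a t.
Proof.
move=> a_le.
pose codes := {dffun forall i : 'I_n, 'I_i.+1}.
pose c s : codes := [ffun i : 'I_n => inord (perm_code s i) : 'I_i.+1].
have c_inj : injective c.
  move=> s s' cs; apply: perm_code_inj => t lt_tn.
  have := congr1 (fun g : codes => val (g (Ordinal lt_tn))) cs.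
  by rewrite !ffunE /= !inordK // ltnS lehmer_le.
(* Both sets have n! elements, so the injection [c] is onto. *)
have : #|codes| <= #|{: 'S_n}|.
  rewrite card_dep_ffun foldrE big_image /= card_Sn fact_prod.
  rewrite big_add1 big_mkord; apply/eq_leq/eq_bigr => i _; exact: card_ord.
move/(inj_card_onto c_inj) => /(_ [ffun i : 'I_n => inord (a i) : 'I_i.+1]).
case/codomP=> s sE.
exists s => t lt_tn.
have := congr1 (fun g : codes => val (g (Ordinal lt_tn))) sE.
by rewrite !ffunE /= !inordK // ltnS ?lehmer_le.
Qed.

End LehmerPerm.

(** * Positions and values turned into insertion times *)

Section ReverseInverse.

Variable n : nat.

Let rev : 'S_n := perm (@rev_ord_inj n).

(* The reverse-complement of the inverse: its value at the [t]-th largest    *)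
(* value of [pi] is the number of letters of [pi] to the right of that value. *)
Definition rev_inv (pi : 'S_n) : 'S_n := (rev * pi^-1 * rev)%g.

Lemma rev_invE pi (m : 'I_n) : rev_inv pi (rev_ord (pi m)) = rev_ord m.
Proof.
have revE i : rev i = rev_ord i by rewrite permE.
by rewrite !permM !revE rev_ordK permK.
Qed.

Lemma rev_invK : involutive rev_inv.
Proof.
have revK : (rev * rev)%g = 1%g.
  by apply/permP => i; rewrite permM !permE rev_ordK.
have revV : rev^-1%g = rev by apply/eqP; rewrite eq_invg_mul revK.
move=> pi; rewrite /rev_inv !invMg invgK revV !mulgA revK mul1g.
by rewrite -mulgA revK mulg1.
Qed.

End ReverseInverse.

(** * Occurrences of the two patterns in a permutation *)

Local Notation i0 := (@Ordinal 3 0 isT).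
Local Notation i1 := (@Ordinal 3 1 isT).
Local Notation i2 := (@Ordinal 3 2 isT).

Lemma forall_ord3 (P : 'I_3 -> bool) :
  [forall j, P j] = [&& P i0, P i1 & P i2].
Proof.
apply/forallP/and3P => [H|[P0 P1 P2] j]; first by split.
by case: j => [[|[|[|//]]] lt_j]; [move: P0|move: P1|move: P2];
   congr (is_true (P _)); apply: val_inj.
Qed.

Lemma enum_ord3 : enum 'I_3 = [:: i0; i1; i2].
Proof. by apply: (inj_map val_inj); rewrite val_enum_ord. Qed.

Definition perm_up (up : bool) : 'S_3 := if up then perm123 else perm132.

Section Occurrences.

Variables (n : nat) (pi : 'S_n) (f : {ffun 'I_3 -> 'I_n}).

Let x := f i0.
Let y := f i1.
Let z := f i2.

Lemma increasing3E : increasing f = (x < y < z).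
Proof. by rewrite /increasing forall_ord3 !forall_ord3 /= -/x -/y -/z; lia. Qed.

Lemma order_isomorphic3E up : order_isomorphic pi f (perm_up up) =
  if up then pi x < pi y < pi z else pi x < pi z < pi y.
Proof.
rewrite /order_isomorphic forall_ord3 !forall_ord3 /= -/x -/y -/z.
by case: up; rewrite /perm_up /perm123 /perm132 ?perm1 ?permE /=; lia.
Qed.

Lemma pos_bounds3E : pos_bounds f = [:: 0; x.+1; y.+1; z.+1; n.+1].
Proof. by rewrite /pos_bounds enum_ord3. Qed.

Lemma val_bounds3E : pi x < minn (pi y) (pi z) ->
  val_bounds pi f =
  [:: 0; (pi x).+1; (minn (pi y) (pi z)).+1; (maxn (pi y) (pi z)).+1; n.+1].
Proof.
move=> lt_x; rewrite /val_bounds enum_ord3; set l := map _ _.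
pose l' := [:: (pi x).+1; (minn (pi y) (pi z)).+1; (maxn (pi y) (pi z)).+1].
suff -> : sort leq l = l' by [].
have <- : sort leq l' = l'.
  by apply: sorted_sort => /=; [exact: leq_trans | lia].
apply/perm_sortP; [exact: leq_total | exact: leq_trans | exact: anti_leq |].
rewrite /l /l' /= -/x -/y -/z perm_cons.
by case: leqP => // _; rewrite -(perm_rot 1).
Qed.

Definition isolated3 : Prop :=
  forall m : 'I_n, x < m -> pi x < pi m -> m = y \/ m = z.

Definition boxes_empty (T : {set 'I_4 * 'I_4}) : Prop :=
  forall ab, ab \in T -> forall m, ~~ in_box pi f ab m.

Lemma boxes_emptyU S T : boxes_empty (S :|: T) <-> boxes_empty S /\ boxes_empty T.
Proof.
split=> [H|[HS HT] ab /setUP[]]; [split=> ab abS; apply: H | exact: HS | exact: HT].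
- by rewrite inE abS.
- by rewrite inE abS orbT.
Qed.

(** The boxes of [B] tile the quadrant above and to the right of the first letter, and by
    injectivity only [y] and [z] lie on the grid lines inside it. *)
Lemma boxes_emptyB : x < y < z -> pi x < minn (pi y) (pi z) ->
  boxes_empty B <-> isolated3.
Proof.
move=> xyz lt_x; have := @val_bounds3E lt_x; have := pos_bounds3E.
rewrite /boxes_empty /in_box => -> ->; split=> [H m lt_xm lt_m|H [[i lti] [j ltj]]].
  have [->|neq_my] := eqVneq m y; first by left.
  have [->|neq_mz] := eqVneq m z; first by right.
  have pmy : pi m != pi y by rewrite (inj_eq perm_inj).
  have pmz : pi m != pi z by rewrite (inj_eq perm_inj).
  move: neq_my neq_mz pmy pmz; rewrite -!val_eqE /= => my mz pmy pmz.
  (* Column and row of the box that contains [m]. *)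
  pose i := if m < y then 1 else if m < z then 2 else 3.
  pose j := if pi m < minn (pi y) (pi z) then 1
            else if pi m < maxn (pi y) (pi z) then 2 else 3.
  have lti : i < 4 by rewrite /i; case: ifP => _; [|case: ifP].
  have ltj : j < 4 by rewrite /j; case: ifP => _; [|case: ifP].
  have ijB : (Ordinal lti, Ordinal ltj) \in B.
    by rewrite inE /= /i /j; do !case: ifP => _.
  have := H _ ijB m; rewrite /= /i /j.
  have := ltn_ord m; have := ltn_ord (pi m).
  by case: ifP => ?; [|case: ifP => ?];
    (case: ifP => ?; [|case: ifP => ?]); rewrite /=; lia.
rewrite inE /= => /andP[i13 j13] m.
case: (ltnP x m) => [lt_xm|le]; last first.
  by case: i => [|[|[|[|?]]]] in lti i13 *; rewrite //=; lia.
case: (ltnP (pi x) (pi m)) => [lt_pm|le]; last first.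
  by case: j => [|[|[|[|?]]]] in ltj j13 *; rewrite //=; lia.
case: (H m lt_xm lt_pm) => ->.
  by case: i => [|[|[|[|?]]]] in lti i13 *; rewrite //=; lia.
by case: i => [|[|[|[|?]]]] in lti i13 *; rewrite //=; lia.
Qed.

Let q := perm_nat (rev_inv pi).
(** The insertion time of the letter at position [m], as values are inserted in decreasing order
    from time 0. *)
Let tm (m : 'I_n) : nat := n - (pi m).+1.

Lemma perm_nat_rev_inv m : q (tm m) = n - m.+1.
Proof. by rewrite /q (perm_natE _ (rev_ord (pi m))) rev_invE. Qed.

Lemma rev_value_surj s : s < n -> exists m, s = tm m.
Proof.
move=> lt_sn; exists ((pi^-1)%g (rev_ord (Ordinal lt_sn))).
by rewrite /tm permKV /=; lia.
Qed.

Lemma in_box3E (ab : 'I_4 * 'I_4) m :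
  x < y < z -> pi x < minn (pi y) (pi z) ->
  (val ab.1, val ab.2) \in axis_boxes ->
  in_box pi f ab m =
  triple_box q (tm x) (tm y) (tm z) (val ab.1, val ab.2) (tm m).
Proof.
move=> xyz lt_x; rewrite /in_box /axis_boxes (val_bounds3E lt_x) pos_bounds3E.
case: ab => [[i lti] [j ltj]] /=.
case: i j lti ltj => [|[|[|?]]] [|[|[|?]]] //= _ _ _;
  rewrite ?perm_nat_rev_inv /tm;
  have := ltn_ord m; have := ltn_ord (pi m); have := ltn_ord z;
  have := ltn_ord (pi y); have := ltn_ord (pi z); lia.
Qed.

Lemma forall_in_boxes (T : {set 'I_4 * 'I_4}) :
  [forall ab in T, forall m : 'I_n, ~~ in_box pi f ab m] <-> boxes_empty T.
Proof.
split=> [/forall_inP H ab abT m|H]; first by have /forallP := H _ abT; apply.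
by apply/forall_inP => ab abT; apply/forallP => m; exact: H.
Qed.

Lemma occurrence3P up T :
  occurrence (@MeshPattern 3 (perm_up up) (B :|: T)) pi f <->
  [/\ x < y < z, pi x < minn (pi y) (pi z), up = (pi y < pi z),
      isolated3 & boxes_empty T].
Proof.
rewrite /occurrence /= increasing3E order_isomorphic3E; split.
  case/and3P => xyz ord /forall_in_boxes/boxes_emptyU[eB eT].
  have lt_x : pi x < minn (pi y) (pi z) by move: ord; case: (up); lia.
  split=> //; last exact/boxes_emptyB.
  by move: ord; case: (up); lia.
case=> xyz lt_x -> /(boxes_emptyB xyz lt_x) eB eT.
rewrite xyz /=; apply/andP; split.
  have : pi y != pi z by rewrite (inj_eq perm_inj) -val_eqE /=; lia.
  by rewrite -val_eqE /=; case: (ltnP (pi y)); lia.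
by apply/forall_in_boxes; apply/boxes_emptyU.
Qed.

Lemma isolated_triple : x < y < z -> pi x < minn (pi y) (pi z) -> isolated3 ->
  [/\ tm y < tm x, tm z < tm x, q (tm z) < q (tm y), q (tm y) < q (tm x) &
    forall s, s < tm x -> q s < q (tm x) -> s = tm y \/ s = tm z].
Proof.
move=> xyz lt_x iso; rewrite !perm_nat_rev_inv /tm.
have := ltn_ord (pi y); have := ltn_ord (pi z); have := ltn_ord z.
split; try lia; move=> s lt_s.
have [|m sE] := @rev_value_surj s; first by lia.
move: lt_s; rewrite {s}sE perm_nat_rev_inv /tm => lt_s lt_m.
case: (iso m) => [||->|->]; [lia | | by left | by right].
by have := ltn_ord (pi x); have := ltn_ord (pi m); lia.
Qed.

Lemma code_occ_triple up (T : {set 'I_4 * 'I_4}) :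
  x < y < z -> pi x < minn (pi y) (pi z) -> isolated3 ->
  {in T, forall ab, (val ab.1, val ab.2) \in axis_boxes} ->
  code_occ n (lehmer q) T up (tm x) <-> up = (pi y < pi z) /\ boxes_empty T.
Proof.
move=> xyz lt_x iso T5.
have [yx zx qzy qyx only] := isolated_triple xyz lt_x iso.
have q_inj : injective q by exact: perm_nat_inj.
have lt_n : tm x < n by rewrite /tm; have := ltn_ord x; lia.
have boxP ab := code_boxP q_inj yx zx qzy qyx only ab lt_n.
rewrite /code_occ (triple_lehmer q_inj yx zx qzy qyx only) eqxx.
rewrite (triple_last q_inj yx zx qzy qyx only).
have -> : tm z < tm y = (pi y < pi z).
  by rewrite /tm; have := ltn_ord (pi y); have := ltn_ord (pi z); lia.
rewrite andTb eq_sym; split.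
  case/andP=> upE /forall_inP H; split.
    by case: (up) (ltnP (pi y)) upE => [] [].
  move=> ab abT m; rewrite in_box3E //; last exact: T5.
  apply: (elimT (boxP _) (H _ abT)); rewrite /tm; have := ltn_ord m; lia.
case=> -> H; rewrite eqxx; apply/forall_inP => ab abT.
apply/(introT (boxP _)) => s lt_s.
have [m ->] := rev_value_surj lt_s.
by rewrite -in_box3E //; [exact: H | exact: T5].
Qed.

End Occurrences.

(** The companions are the only letters in the quadrant of the first letter, and their positions fix
    their order. *)
Lemma isolated3_inj n (pi : 'S_n) (f f' : {ffun 'I_3 -> 'I_n}) :
  f i0 < f i1 < f i2 -> f' i0 < f' i1 < f' i2 ->
  pi (f i0) < minn (pi (f i1)) (pi (f i2)) ->
  pi (f' i0) < minn (pi (f' i1)) (pi (f' i2)) ->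
  isolated3 pi f -> f i0 = f' i0 -> f = f'.
Proof.
move=> xyz xyz' lt_x lt_x' iso e0.
have e1 := iso (f' i1); have e2 := iso (f' i2).
rewrite -e0 in xyz' lt_x'.
have {}e1 : f' i1 = f i1 \/
            f' i1 = f i2 by apply: e1; lia.
have {}e2 : f' i2 = f i1 \/
            f' i2 = f i2 by apply: e2; lia.
have {}e2 : f' i2 = f i2.
  by case: e1 e2 xyz' => -> [] -> //; lia.
have {}e1 : f' i1 = f i1.
  by case: e1 xyz' => -> //; rewrite e2; lia.
apply/ffunP => j; apply/eqP; move: j; apply/forallP.
by rewrite forall_ord3 e0 e1 e2 !eqxx.
Qed.

Lemma num_occ_code n (pi : 'S_n) up (T : {set 'I_4 * 'I_4}) :
  {in T, forall ab, (val ab.1, val ab.2) \in axis_boxes} ->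
  num_occ (@MeshPattern 3 (perm_up up) (B :|: T)) pi =
  #|[set t : 'I_n | code_occ n (perm_code (rev_inv pi)) T up t]|.
Proof.
move=> T5; rewrite /num_occ.
(* An occurrence is recorded by the insertion time of its first letter. *)
pose g (f : {ffun 'I_3 -> 'I_n}) := rev_ord (pi (f i0)).
rewrite -(@card_in_imset _ _ g); last first.
  move=> f f'; rewrite !inE => /occurrence3P[xyz lt_x _ iso _].
  move=> /occurrence3P[xyz' lt_x' _ _ _].
  by move=> /rev_ord_inj/perm_inj/(isolated3_inj xyz xyz' lt_x lt_x' iso).
apply: eq_card => t; rewrite !inE; apply/imsetP/idP => [[f]|].
  rewrite inE => /occurrence3P[xyz lt_x upE iso eT] ->.
  by apply/(code_occ_triple up xyz lt_x iso T5).
(* Conversely, the entry 2 at time [t] yields the companions, and these form an occurrence. *)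
move=> occ; have /and3P[/eqP a2 _ _] := occ.
have q_inj := @perm_nat_inj _ (rev_inv pi).
have [y' [z' [yt zt qzy qyt only]]] := lehmer_eq2P q_inj a2.
have [x xE] := rev_value_surj pi (ltn_ord t).
have [y yE] := rev_value_surj pi (ltn_trans yt (ltn_ord t)).
have [z zE] := rev_value_surj pi (ltn_trans zt (ltn_ord t)).
pose f := [ffun j : 'I_3 => nth x [:: x; y; z] j].
exists f; last by apply: val_inj; rewrite /g ffunE /= xE.
rewrite ?xE ?yE ?zE in yt zt qzy qyt only.
rewrite ?perm_nat_rev_inv in qzy qyt only.
have f0 : f i0 = x by rewrite ffunE.
have f1 : f i1 = y by rewrite ffunE.
have f2 : f i2 = z by rewrite ffunE.
have := ltn_ord x; have := ltn_ord y; have := ltn_ord z => ? ? ?.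
have xyz : f i0 < f i1 < f i2.
  by rewrite f0 f1 f2; lia.
have lt_x : pi (f i0) < minn (pi (f i1)) (pi (f i2)).
  by rewrite f0 f1 f2; lia.
have iso : isolated3 pi f.
  move=> m; rewrite f0 f1 f2 => lt_xm lt_m.
  have time_inj m' : n - (pi m).+1 = n - (pi m').+1 -> m = m'.
    move=> e; apply/(@perm_inj _ pi)/val_inj => /=.
    by have := ltn_ord (pi m); have := ltn_ord (pi m'); lia.
  have [|||] := only (n - (pi m).+1).
  - by have := ltn_ord (pi m); lia.
  - by rewrite perm_nat_rev_inv; have := ltn_ord m; lia.
  - by move/time_inj; left.
  - by move/time_inj; right.
have := code_occ_triple up xyz lt_x iso T5; rewrite f0 -xE.
case=> /(_ occ)[upE eT] _.
by rewrite inE; apply/occurrence3P; split.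
Qed.

(** * Transfer of the flip to permutations *)

Lemma equidistributed_flip (T : {set 'I_4 * 'I_4}) :
  {in T, forall ab, (val ab.1, val ab.2) \in axis_boxes} ->
  (forall ab, ab \in T -> (val ab.1, val ab.2) = (2, 0) -> flip_boxes T) ->
  @MeshPattern 3 perm123 (B :|: T) ~d @MeshPattern 3 perm132 (B :|: T).
Proof.
move=> T5 Tb n l.
pose code (pi : 'S_n) := perm_code (rev_inv pi).
have code_le pi t : code pi t <= t by exact: lehmer_le.
have ex_flip pi :
    exists pi', [forall t : 'I_n, code pi' t == flip (flip_boxes T) (code pi) t].
  have [|s sE] := @perm_code_surj n (flip (flip_boxes T) (code pi)).
    by move=> t; exact: flip_valid.
  by exists (rev_inv s); apply/forallP => t; rewrite /code rev_invK sE.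
pose phi pi := xchoose (ex_flip pi).
have phiE pi t : t < n -> code (phi pi) t = flip (flip_boxes T) (code pi) t.
  by move=> lt_tn; have /forallP/(_ (Ordinal lt_tn))/eqP := xchooseP (ex_flip pi).
have phi_occ pi : num_occ (@MeshPattern 3 perm132 (B :|: T)) (phi pi) =
                  num_occ (@MeshPattern 3 perm123 (B :|: T)) pi.
  rewrite (@num_occ_code _ _ false) // (@num_occ_code _ _ true) //.
  apply: eq_card => t; rewrite !inE (eq_code_occ _ _ (phiE pi)) //.
  exact: (code_occ_flip true).
have phi_inj : injective phi.
  move=> p1 p2 e; apply: (can_inj (@rev_invK n)); apply: perm_code_inj => t lt_tn.
  rewrite -[LHS](flipK (flip_boxes T)) -[RHS](flipK (flip_boxes T)).
  (* The flip may look at entry [n], which equals [n] for every permutation. *)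
  apply: eq_flip lt_tn => [u lt_un|]; first by rewrite -!phiE // e.
  by rewrite !(ltnNge 1) !flip_le // !perm_code_n.
rewrite -(card_imset _ phi_inj); apply: eq_card => pi; rewrite !inE.
have [psi phiK psiK] := injF_bij phi_inj.
apply/imsetP/idP => [[pi' ] | occ]; first by rewrite inE -phi_occ => /[swap] ->.
by exists (psi pi); rewrite ?psiK // inE -phi_occ psiK.
Qed.

Lemma equidistributed_boxes3 (s : seq (nat * nat)) :
  {subset s <= axis_boxes} -> ((2, 0) \in s -> (0, 2) \in s) ->
  @MeshPattern 3 perm123 (B :|: boxes3 s) ~d @MeshPattern 3 perm132 (B :|: boxes3 s).
Proof.
move=> s_axis s02; apply: equidistributed_flip => ab; rewrite inE.
  exact: s_axis.
move=> abs ab20; apply/exists_inP; exists (@Ordinal 4 0 isT, @Ordinal 4 2 isT) => //.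
by rewrite inE /=; apply: s02; rewrite -ab20.
Qed.

Theorem theorem4p2 (T : {set 'I_4 * 'I_4}) :
  T \in [:: boxes3 [:: (0, 0)];
            boxes3 [:: (0, 1); (1, 0)];
            boxes3 [:: (0, 0); (0, 1); (1, 0)];
            boxes3 [:: (0, 2); (2, 0)];
            boxes3 [:: (0, 0); (0, 2); (2, 0)];
            boxes3 [:: (0, 1); (0, 2); (1, 0); (2, 0)];
            boxes3 [:: (0, 0); (0, 1); (0, 2); (1, 0); (2, 0)]] ->
  @MeshPattern 3 perm123 (B :|: T) ~d @MeshPattern 3 perm132 (B :|: T).
Proof.
rewrite !inE.
by do !case/orP; move=> /eqP->; apply: equidistributed_boxes3 => //; apply/allP.
Qed.
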